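(* For all positive integers $n, k$ with $k \ge 2$, $$\operatorname{disc}^{\max}(n,k) \ \ge\ \frac{\sqrt{n-1}}{16}.$$
   Context: $\mathbb{N}$ denotes the positive integers and $[m]=\{1,\dots,m\}$. $\mathbf{1}$ is the all-ones vector in $\mathbb{R}^m$, and for $S\subseteq[m]$, $\mathbf{1}(S)\in\{0,1\}^m$ is the indicator vector of $S$. For a matrix $\mathbf{A}\in[0,1]^{n\times m}$ and $k\in\mathbb{N}$, the $k$-color discrepancy of $\mathbf{A}$ is $$\operatorname{disc}(\mathbf{A},k) := \min_{\chi:[m]\to[k]}\ \max_{s\in[k]} \left\|\mathbf{A}\left(\tfrac1k\cdot\mathbf{1}-\mathbf{1}(\chi^{-1}(s))\right)\right\|_\infty.$$ Define $\operatorname{disc}^{\max}(n,k) := \sup_{m\in\mathbb{N}}\ \sup_{\mathbf{A}\in[0,1]^{n\times m}} \operatorname{disc}(\mathbf{A},k)$. *)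

(* Defs.v *)
From HB Require Import structures.
From mathcomp Require Import all_boot all_order all_algebra.
From mathcomp Require Import all_classical all_reals all_analysis.

Set Implicit Arguments.
Unset Strict Implicit.
Unset Printing Implicit Defensive.

Import Order.TTheory GRing.Theory Num.Theory.
Import numFieldNormedType.Exports.

Local Open Scope classical_set_scope.
Local Open Scope ring_scope.

Definition indic_cV (R : realType) (m : nat) (S : {set 'I_m}) : 'cV[R]_m :=
  \col_j (j \in S)%:R.

(* The norm on ['cV[R]_n] is the sup norm ([mx_normrE]).  The idle value [0] of
   the maximum is harmless since norms are nonnegative. *)
Definition coloring_disc (R : realType) (n m k : nat) (A : 'M[R]_(n, m))
    (chi : {ffun 'I_m -> 'I_k}) : R :=
  \big[Num.max/0]_(s < k)
    `| A *m (k%:R^-1 *: const_mx 1 - indic_cV R (chi @^-1: [set s])%SET) |.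

(* The minimum is taken in the extended reals so that its idle value [+oo] is
   neutral: for [0 < k] there is at least one coloring and [disc A k] is the
   (finite) least value of [coloring_disc A]. *)
Definition disc (R : realType) (n m : nat) (A : 'M[R]_(n, m)) (k : nat) :
    \bar R :=
  \big[mine/+oo%E]_(chi : {ffun 'I_m -> 'I_k}) (coloring_disc A chi)%:E.

Definition unit_matrices (R : realType) (n m : nat) : set 'M[R]_(n, m) :=
  [set A | forall i j, 0 <= A i j <= 1].

Definition disc_max (R : realType) (n k : nat) : \bar R :=
  ereal_sup [set ereal_sup [set disc A k | A in @unit_matrices R n m]
            | m in [set m : nat | (0 < m)%N]].

(* Main.v *)
(** Take a Hadamard matrix [H] of order [N = 2 ^ p] with [N <= n < 2 N] and a
    row of ones, and repeat each column [k./2] times.  Whatever the coloring, a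
    given color occurs a natural number [c] of times among the copies of a given
    column, and [c] differs from the fair share [k./2 / k] by at least [1/3].
    Hence for each color the discrepancy vector is [H w] with all entries of [w]
    at least [1/3] in absolute value, and
    [|H w|_2 ^ 2 = N |w|_2 ^ 2 >= N ^ 2 / 9].  Passing from [H] to the [0/1]
    matrix [(1 + H) / 2] loses at most a factor 3, thanks to the row of ones. *)
Require Import Defs.
From HB Require Import structures.
From mathcomp Require Import all_boot all_order all_algebra.
From mathcomp Require Import all_classical all_reals all_analysis.
From mathcomp Require Import ring lra zify.

Import Order.TTheory GRing.Theory Num.Theory.
Import numFieldNormedType.Exports.

Local Open Scope ring_scope.

Lemma ler_entry_mx_norm (R : realType) (m n : nat) (M : 'M[R]_(m, n))
    (i : 'I_m) (j : 'I_n) : `|M i j| <= `|M|.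
Proof.
have -> : `|M| = mx_norm M by [].
rewrite mx_normrE.
exact: (le_bigmax _ (fun ij => `|M ij.1 ij.2|) (i, j)).
Qed.

(** Sylvester's doubling: in [[[H, H], [H, -H]]] the off-diagonal blocks of the Gram matrix cancel,
    and a row of ones in the top half stays one. *)
Lemma hadamard_pow2 (R : realType) (p : nat) :
  exists H : 'M[R]_(2 ^ p),
    [/\ forall i j, (H i j == 1) || (H i j == -1),
        H^T *m H = ((2 ^ p)%:R)%:M &
        exists i0, forall j, H i0 j = 1].
Proof.
elim: p => [|p [H [Hpm HH [i0 Hi0]]]].
  exists (const_mx 1); split.
  - by move=> i j; rewrite mxE eqxx.
  - apply/matrixP => i j; rewrite !mxE big_ord1 !mxE mulr1.
    by rewrite (ord1 i) (ord1 j) eqxx.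
  - by exists ord0 => j; rewrite mxE.
rewrite expnS mul2n -addnn; exists (block_mx H H H (- H)); split.
- move=> i j.
  case: (split_ordP i) => i' ->; case: (split_ordP j) => j' ->;
    rewrite ?(block_mxEul, block_mxEur, block_mxEdl, block_mxEdr) ?Hpm //.
  by rewrite mxE eqr_oppLR eqr_opp orbC Hpm.
- rewrite tr_block_mx mulmx_block [(- H)^T]linearN /= !(mulNmx, mulmxN) opprK.
  by rewrite HH subrr -raddfD /= -natrD -scalar_mx_block.
- exists (lshift _ i0) => j.
  by case: (split_ordP j) => j' ->; rewrite ?(block_mxEul, block_mxEur) Hi0.
Qed.

Lemma sum_sqr_mulmx_orthogonal (R : realType) (N : nat) (c : R)
    (H : 'M[R]_N) (w : 'cV[R]_N) (HH : H^T *m H = c%:M) :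
  \sum_i (H *m w) i 0 ^+ 2 = c * \sum_i w i 0 ^+ 2.
Proof.
have sq (v : 'cV[R]_N) : \sum_i v i 0 ^+ 2 = (v^T *m v) 0 0.
  by rewrite mxE; apply: eq_bigr => i _; rewrite mxE expr2.
rewrite !sq trmx_mul mulmxA -(mulmxA w^T) HH mul_mx_scalar -scalemxAl.
by rewrite mxE.
Qed.

(** The ratio lies in [[1/3, 2/3]], hence [1/3] away from both 0 and 1; [k = 3] attains the
    bound. *)
Lemma half_ratio_far_nat (R : realType) (k c : nat) (hk : (2 <= k)%N) :
  1 / 3 <= `|(k./2)%:R / k%:R - c%:R| :> R.
Proof.
have k0 : 0 < k%:R :> R by rewrite ltr0n; lia.
have lo : k%:R <= 3 * (k./2)%:R :> R by rewrite -natrM ler_nat; lia.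
have hi : 3 * (k./2)%:R <= 2 * k%:R :> R by rewrite -!natrM ler_nat; lia.
have lo' : 1 / 3 <= (k./2)%:R / k%:R :> R by rewrite ler_pdivlMr //; lra.
have hi' : (k./2)%:R / k%:R <= 2 / 3 :> R by rewrite ler_pdivrMr //; lra.
rewrite ler_normr; case: c => [|c]; first by apply/orP; left; lra.
apply/orP; right.
have : 1 <= c.+1%:R :> R by rewrite ler1n.
lra.
Qed.

Lemma sqr_le_sum_sqr_far (R : realType) (N : nat) (w : 'cV[R]_N) (a : R)
    (a0 : 0 <= a) (hw : forall i, a <= `|w i 0|) :
  N%:R * a ^+ 2 <= \sum_i w i 0 ^+ 2.
Proof.
rewrite -[N in N%:R]card_ord mulr_natl -sumr_const.
apply: ler_sum => i _; rewrite -[leRHS]real_normK ?num_real //.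
by rewrite lerXn2r ?nnegrE.
Qed.

(** Column [j] copies column [b j] of [(1 + H) / 2]. Rows of index at least [N] are zero padding,
    supplied by the default of [oapp], so [n] may exceed [N]. *)
Definition blowup (R : realType) (N n m : nat) (H : 'M[R]_N)
    (b : 'I_m -> 'I_N) : 'M[R]_(n, m) :=
  \matrix_(i, j)
    oapp (fun i' : 'I_N => (1 + H i' (b j)) / 2) 0 (insub (i : nat)).

Lemma blowup_mulE (R : realType) (N n m : nat) (H : 'M[R]_N)
    (b : 'I_m -> 'I_N) (z : 'cV[R]_m) (w : 'cV[R]_N) (leNn : (N <= n)%N)
    (hw : forall i, w i 0 = \sum_(j | b j == i) z j 0) (i : 'I_N) :
  (blowup R N n m H b *m z) (widen_ord leNn i) 0
  = (\sum_l w l 0 + (H *m w) i 0) / 2.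
Proof.
rewrite !mxE -big_split /= big_distrl /= (partition_big b xpredT) //=.
apply: eq_bigr => l _.
rewrite hw -[X in X + _]mul1r -mulrDl mulrAC big_distrr /=.
apply: eq_bigr => j /eqP bj.
by rewrite mxE valK /= bj.
Qed.

(** The constant 81 is [9 * 9]: one factor from entries of [w] of size at least [1/3], the other
    from the factor 3 lost between [H] and [(1 + H) / 2]. *)
Lemma coloring_disc_blowup (R : realType) (N n m k : nat) (H : 'M[R]_N)
    (b : 'I_m -> 'I_N) (chi : {ffun 'I_m -> 'I_k})
    (leNn : (N <= n)%N) (hk : (2 <= k)%N)
    (HH : H^T *m H = (N%:R)%:M) (i0 : 'I_N) (Hi0 : forall j, H i0 j = 1)
    (hb : forall i, #|[pred j | b j == i]| = k./2) :
  N%:R <= 81 * coloring_disc (blowup R N n m H b) chi ^+ 2.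
Proof.
set A := blowup R N n m H b; set D := coloring_disc A chi.
have k0 : (0 < k)%N by lia.
(* The bound holds for every single color, so color 0 suffices. *)
pose s : 'I_k := Ordinal k0.
set z : 'cV[R]_m := k%:R^-1 *: const_mx 1 - indic_cV R (chi @^-1: [set s])%SET.
have zD i : `|(A *m z) i 0| <= D.
  apply: le_trans (ler_entry_mx_norm _ _ _ _ i 0) _.
  exact: (le_bigmax _ (fun s : 'I_k => `|A *m
    (k%:R^-1 *: const_mx 1 - indic_cV R (chi @^-1: [set s])%SET)|) s).
pose w : 'cV[R]_N := \col_i \sum_(j | b j == i) z j 0.
have hw i : w i 0 = \sum_(j | b j == i) z j 0 by rewrite mxE.
have w_far i : 1 / 3 <= `|w i 0|.
  have -> : w i 0 = (k./2)%:R / k%:R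
      - (\sum_(j | b j == i) (j \in (chi @^-1: [set s])%SET))%:R.
    rewrite hw natr_sum -(hb i) mulr_natl -sumr_const -sumrB.
    by apply: eq_bigr => j _; rewrite !mxE mulr1.
  exact: half_ratio_far_nat.
have AE i := blowup_mulE R N n m H b z w leNn hw i.
(* With [S] the sum of the entries of [w], row [i0] of [A *m z] is [(S + S) / 2 = S], so [S] is at
   most [D] in absolute value. Any other entry of [H *m w] is twice an entry of [A *m z] minus [S],
   hence at most [3 * D]. *)
have Hw0 : (H *m w) i0 0 = \sum_l w l 0.
  by rewrite mxE; apply: eq_bigr => l _; rewrite Hi0 mul1r.
have HwD i : (H *m w) i 0 ^+ 2 <= 9 * D ^+ 2.
  have := zD (widen_ord leNn i0); have := zD (widen_ord leNn i).
  rewrite !AE Hw0 !ler_norml => /andP[? ?] /andP[? ?].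
  have : `|(H *m w) i 0| <= 3 * D by rewrite ler_norml; lra.
  have D0 : 0 <= D by lra.
  move=> le3; rewrite -[leLHS]real_normK ?num_real //.
  have -> : 9 * D ^+ 2 = (3 * D) ^+ 2 by ring.
  by rewrite lerXn2r ?nnegrE //; lra.
have N0 : 0 < N%:R :> R by rewrite ltr0n; apply: leq_ltn_trans (ltn_ord i0).
have up : \sum_i (H *m w) i 0 ^+ 2 <= N%:R * (9 * D ^+ 2).
  rewrite -[N in N%:R]card_ord mulr_natl -sumr_const.
  by apply: ler_sum => i _.
have := sqr_le_sum_sqr_far R N w (1 / 3) ltac:(lra) w_far.
move: up; rewrite (sum_sqr_mulmx_orthogonal R N N%:R) // ler_pM2l //.
lra.
Qed.

Theorem corollary3p3 (R : realType) (n k : nat) (hn : (0 < n)%N)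
    (hk : (2 <= k)%N) :
  ((Num.sqrt (n%:R - 1) / 16)%:E <= disc_max R n k)%E.
Proof.
have /andP[leNn ltn2N] := trunc_log_bounds (isT : (1 < 2)%N) hn.
move: leNn ltn2N; set p := trunc_log 2 n => leNn ltn2N.
have [H [Hpm HH [i0 Hi0]]] := hadamard_pow2 R p.
have N0 : (0 < 2 ^ p)%N by rewrite expn_gt0.
rewrite expnS in ltn2N.
set N := (2 ^ p)%N in H Hpm HH i0 Hi0 leNn ltn2N N0 *.
(* Columns are pairs of a column of [H] and a copy number; [b] forgets the copy number. *)
pose T : finType := ('I_N * 'I_(k./2))%type.
pose b (j : 'I_#|T|) : 'I_N := (enum_val j).1.
have hb i : #|[pred j | b j == i]| = k./2.
  rewrite -sum1_card.
  rewrite (reindex_onto (@enum_rank T) (@enum_val T T)) /=; last first.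
    by move=> j _; rewrite enum_valK.
  under eq_bigl => x do rewrite !inE /b enum_rankK eqxx.
  rewrite -(pair_big (pred1 i) predT (fun _ _ => 1%N)) /=.
  by rewrite big_pred1_eq sum1_card card_ord.
have m0 : (0 < #|T|)%N by rewrite card_prod !card_ord muln_gt0 N0; lia.
pose A := blowup R N n #|T| H b.
apply: le_ereal_sup_tmp.
exists (ereal_sup [set disc A k | A in @unit_matrices R n #|T|]%classic).
  by exists #|T|.
apply: le_ereal_sup_tmp; exists (disc A k).
  exists A => // i j; rewrite mxE; case: insubP => [i' _ _|_] /=; last by lra.
  by have /orP[] := Hpm i' (b j) => /eqP ->; lra.
(* The idle value [+oo] of the minimum satisfies the bound trivially. *)
apply: le_bigmin => [|chi _]; first exact: leey.
rewrite lee_fin.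
have := coloring_disc_blowup R N n #|T| k H b chi leNn hk HH i0 Hi0 hb.
have D0 : 0 <= coloring_disc (blowup R N n #|T| H b) chi.
  exact: bigmax_ge_id.
rewrite -/A in D0 *; set D := coloring_disc A chi in D0 * => le81.
have n1 : 0 <= n%:R - 1 :> R by rewrite subr_ge0 ler1n.
have n2N : n%:R <= 2 * N%:R :> R by rewrite -natrM ler_nat; lia.
(* After squaring, the claim is [n - 1 <= 256 * D ^+ 2], which follows from
   [n <= 2 * N <= 162 * D ^+ 2]. *)
rewrite ler_pdivrMr // -(@ger0_norm _ (D * 16)) ?mulr_ge0 // -sqrtr_sqr.
apply: ler_wsqrtr.
have -> : (D * 16) ^+ 2 = 256 * D ^+ 2 by ring.
have : 0 <= D ^+ 2 by exact: sqr_ge0.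
lra.
Qed.
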